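(* Let $n>4$. For every colored triangle-free triangulation $T\in CTFT(n)$, along every shortest path in the flip graph $\Gamma_n$ from $T$ to $T^R$ (the same triangulation with reversed coloring), every diagonal of the convex $n$-gon is flipped exactly once.
   Context: Label the vertices of a convex $n$-gon $P_n$ cyclically by the elements $0,1,\ldots,n-1$ of $\mathbb{Z}_n$. Triangulations of $P_n$ have no extra vertices. Edges of the polygon are external edges; all other edges of a triangulation are internal edges, or chords. A triangulation is triangle-free if it contains no triangle with three internal edges. A chord is short if it connects vertices $i-1$ and $i+1$ for some $i\in\mathbb{Z}_n$; a triangle-free triangulation contains exactly two short chords. A proper coloring of a triangle-free triangulation is a labeling of its $n-3$ chords by $0,\ldots,n-4$ (each label used once) such that one of the short chords is labeled $0$ and, whenever a triangle has exactly two internal edges, their labels are consecutive integers $i,i+1$. $CTFT(n)$ is the set of all properly colored triangle-free triangulations of $P_n$. Each chord is a diagonal of a unique quadrangle (the union of the two adjacent triangles); replacing the chord by the other diagonal of that quadrangle is a flip of the chord; in a colored triangulation the new diagonal receives the label of the flipped one. A diagonal is flipped at a step of a path if it is the chord that is erased and replaced at that step. The colored flip graph $\Gamma_n$ has vertex set $CTFT(n)$; two elements are joined by an edge if one is obtained from the other by a flip of a chord. For $T\in CTFT(n)$, $T^R\in CTFT(n)$ is the same triangulation with the chord labeled $i$ in $T$ relabeled $n-4-i$, for $0\le i\le n-4$. *)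

(* Defs.v *)
From mathcomp Require Import all_boot.

Set Implicit Arguments.
Unset Strict Implicit.
Unset Printing Implicit Defensive.

(* The vertices of P_n are the elements of 'I_n in cyclic order, with [ordS]
   and [ord_pred] the cyclic successor and predecessor; a segment between two
   vertices is the set of its endpoints. *)

(* A labeled family of n - 3 segments: [T k] is the segment labeled k. *)
Notation coloring n := {ffun 'I_(n - 3) -> {set 'I_n}}.

Section Polygon.

Variable n : nat.

Implicit Types (e f d t : {set 'I_n}) (D : {set {set 'I_n}}).

Definition external : {set {set 'I_n}} := [set [set i; ordS i] | i : 'I_n].

Definition diagonal e : bool := (#|e| == 2) && (e \notin external).

Definition short e : bool := [exists i : 'I_n, e == [set ord_pred i; ordS i]].

(* Two segments of a convex polygon have a common interior point iff their
   endpoints are distinct and alternate around the polygon. *)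
Definition alternate e f : bool :=
  [exists a : 'I_n, exists b : 'I_n, exists c : 'I_n, exists d : 'I_n,
    [&& a < b, b < c, c < d, e == [set a; c] & f == [set b; d]]].

Definition crossing e f : bool := alternate e f || alternate f e.

Definition noncrossing D : bool :=
  [forall e in D, diagonal e] && [forall e in D, forall f in D, ~~ crossing e f].

(* A triangulation is given by its set of chords. *)
Definition triangulation D : bool := maxset noncrossing D.

(* As there are no vertices inside P_n, three vertices that are pairwise
   joined by edges of a triangulation always bound one of its triangles. *)
Definition triangle D t : bool :=
  (#|t| == 3) &&
  [forall e : {set 'I_n},
    (e \subset t) && (#|e| == 2) ==> (e \in D :|: external)].

Definition internal_edges D t : {set {set 'I_n}} := [set e in D | e \subset t].

Definition triangle_free D : bool :=
  [forall t, triangle D t ==> (#|internal_edges D t| != 3)].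

Implicit Types (T U : coloring n).

Definition chords T : {set {set 'I_n}} := [set T k | k : 'I_(n - 3)].

Definition proper_coloring T : bool :=
  [&& injectiveb T,
      [exists k : 'I_(n - 3), (k == 0 :> nat) && short (T k)] &
      [forall t, triangle (chords T) t && (#|internal_edges (chords T) t| == 2)
        ==> [exists i : 'I_(n - 3), exists j : 'I_(n - 3),
              (j == i.+1 :> nat) &&
              (internal_edges (chords T) t == [set T i; T j])]]].

Definition CTFT : {set coloring n} :=
  [set T | [&& triangulation (chords T), triangle_free (chords T)
             & proper_coloring T]].

(* The union of two distinct triangles t1, t2 on the chord [T k] is the
   quadrangle having that chord as a diagonal; the other diagonal joins the two
   vertices of the quadrangle that are not on the chord. *)
Definition flip (k : 'I_(n - 3)) T U : bool :=
  [exists t1, exists t2,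
    [&& triangle (chords T) t1, triangle (chords T) t2, t1 != t2,
        T k \subset t1, T k \subset t2 &
        U == [ffun j => if j == k then (t1 :|: t2) :\: T k else T j]]].

(* The graph Gamma_n, as its adjacency relation. *)
Definition flip_graph : rel (coloring n) := fun T U =>
  [&& T \in CTFT, U \in CTFT & [exists k, flip k T U || flip k U T]].

Definition reversal T : coloring n := [ffun k => T (rev_ord k)].

Definition flipped d T U : bool := (d \in chords T) && (d \notin chords U).

Definition flip_count d T (p : seq (coloring n)) : nat :=
  count (fun s : coloring n * coloring n => flipped d s.1 s.2) (pairmap pair T p).

End Polygon.

(* The sequence x :: p is a shortest path from x to y in the graph e. *)
Definition shortest_path (V : eqType) (e : rel V) (x y : V) (p : seq V) : Prop :=
  [/\ path e x p, last x p = y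
    & forall q : seq V, path e x q -> last x q = y -> size p <= size q].

(* Main.v *)
Require Import Defs.
From mathcomp Require Import all_boot.
From mathcomp Require Import all_order all_algebra zify.

Set Implicit Arguments.
Unset Strict Implicit.
Unset Printing Implicit Defensive.

Import Order.TTheory GRing.Theory Num.Theory.

(** The vertices of the polygon are unrolled to the integers. Read in the order
of their labels, the chords of a properly colored triangle-free triangulation
sweep the polygon: chord 0 cuts off one vertex, and each further chord cuts off
one vertex more, on the left or on the right. So chord k joins the residues of
[l k] and [l k + k + 2] for an integer sequence [l] of length n - 3 that stays
or goes down by 1 at each step ([CTFT_strip]), every such sequence arises
([strip_CTFT]), and it is determined up to a common multiple of n
([strip_eq]). Here n > 4 matters: it makes a chord of length 2 different from
its complement of length n - 2.

A flip at label k moves [l k] by 1 and fixes the other terms ([strip_step],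
[strip_raise]). Reversing the coloring exchanges the two sides of every chord:
up to multiples of n, the new sequence is [opposite l], whose term k is
[l (n - 4 - k) - (k + 2)].

Lower bound. Along any path from T to its reversal the sequence goes from [l] to
[opposite l + q * n] for some integer q, in steps of 1 at one label at a time.
So label k leaves every integer of the interval between these values
([path_cover]). If q > 0 the interval of label k contains that from [l k] to
[opposite l k + n]. The chords of label n - 4 - k have the complementary length;
seen from their other side, they continue those of label k from there up to
[l k + n]. If q <= 0 the same happens downwards. Together the two labels meet
all residues, so every diagonal is erased at least once
([every_diagonal_flipped]).

Upper bound. Any sequence can be raised to any larger one by single steps
([strip_path]), and going from [l] to [opposite l + n] takes
(n - 2) + (n - 3) + ... + 2 steps, which is the number n (n - 3) / 2 of
diagonals ([reversal_path]).

Each step erases exactly one diagonal, so a shortest path erases at most as many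
diagonals, counted with repetition, as there are, and each of them at least
once: hence each exactly once. *)

Section Lift.

Variable m : nat.
Local Notation n := m.+4.+1.

Local Open Scope ring_scope.

(** * Unrolling the polygon to the integers *)

Definition vtx (z : int) : 'I_n := inord `|(z %% n)%Z|%N.

Lemma val_vtx z : (vtx z : nat)%:Z = (z %% n)%Z.
Proof.
rewrite /vtx inordK; first by have := modz_ge0 z (isT : n%:Z != 0); lia.
have := modz_ge0 z (isT : n%:Z != 0).
have := ltz_pmod z (isT : 0 < n%:Z); lia.
Qed.

Lemma vtxDM z q : vtx (z + q * n%:Z) = vtx z.
Proof. by rewrite /vtx addrC modzMDl. Qed.

Lemma vtxD z : vtx (z + n%:Z) = vtx z.
Proof. by rewrite -[RHS](vtxDM _ 1) mul1r. Qed.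

Lemma vtxB z : vtx (z - n%:Z) = vtx z.
Proof. by rewrite -[LHS]vtxD subrK. Qed.

Lemma vtx_eq a b : vtx a = vtx b -> exists q, a = b + q * n%:Z.
Proof.
move=> /(congr1 (fun i : 'I_n => (i : nat)%:Z)); rewrite !val_vtx => eq_ab.
exists ((a %/ n)%Z - (b %/ n)%Z).
by rewrite {1}(divz_eq a n) {1}(divz_eq b n) eq_ab mulrBl; lia.
Qed.

(** Equality of residues in a form that linear arithmetic can use: the unknown
quotient is eliminated once and for all. *)
Lemma vtx_near a b : vtx a = vtx b -> - (2 * n%:Z) < a - b < 2 * n%:Z ->
  a = b \/ a = b + n%:Z \/ a = b - n%:Z.
Proof.
move=> /vtx_eq[q ->] bnd.
have q_val : q = 0 \/ q = 1 \/ q = -1 by nia.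
by case: q_val => [->|[->|->]]; lia.
Qed.

Lemma vtx_window a b : vtx a = vtx b -> - n%:Z < a - b < n%:Z -> a = b.
Proof. by move=> /vtx_near; lia. Qed.

Lemma vtx_small (i : 'I_n) : vtx (i : nat)%:Z = i.
Proof.
apply/val_inj/eqP; rewrite -eqz_nat val_vtx modz_small //.
by have := ltn_ord i; lia.
Qed.

Lemma vtx_lift L i : exists2 z, L <= z < L + n%:Z & vtx z = i.
Proof.
pose r := (((i : nat)%:Z - L) %% n)%Z; exists (L + r).
  have := modz_ge0 ((i : nat)%:Z - L) (isT : n%:Z != 0).
  have := ltz_pmod ((i : nat)%:Z - L) (isT : 0 < n%:Z); rewrite -/r; lia.
rewrite -[RHS]vtx_small -(vtxDM _ (((i : nat)%:Z - L) %/ n)%Z); congr vtx.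
have := divz_eq ((i : nat)%:Z - L) n; rewrite -/r; lia.
Qed.

Lemma ordS_vtx z : ordS (vtx z) = vtx (z + 1).
Proof.
apply/val_inj/eqP; rewrite /= -eqz_nat; apply/eqP.
by rewrite val_vtx -modz_nat -addn1 PoszD val_vtx modzDml.
Qed.

Lemma ord_pred_vtx z : ord_pred (vtx z) = vtx (z - 1).
Proof. by rewrite -{1}(subrK 1 z) -ordS_vtx ordSK. Qed.

Definition edge a b : {set 'I_n} := [set vtx a; vtx b].

Lemma edgeC a b : edge a b = edge b a.
Proof. exact: setUC. Qed.

Lemma edgeDM a b q : edge (a + q * n%:Z) (b + q * n%:Z) = edge a b.
Proof. by rewrite /edge !vtxDM. Qed.

Lemma edgeD a b : edge a (b + n%:Z) = edge b a.
Proof. by rewrite /edge vtxD setUC. Qed.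

Lemma eq_set2 (U : finType) (x y z t : U) :
  [set x; y] = [set z; t] -> (x = z /\ y = t) \/ (x = t /\ y = z).
Proof.
move=> eq_xy.
have: x \in [set z; t] by rewrite -eq_xy set21.
have: y \in [set z; t] by rewrite -eq_xy set22.
have: z \in [set x; y] by rewrite eq_xy set21.
have: t \in [set x; y] by rewrite eq_xy set22.
rewrite !inE => /orP[]/eqP ht /orP[]/eqP hz /orP[]/eqP hy /orP[]/eqP hx;
  by [left; split; congruence | right; split; congruence].
Qed.

(** Inside one window of n consecutive integers the lifts of both endpoints are
unique, so an edge with ordered endpoints has only one lift. *)
Lemma edge_window L a b c d : edge a b = edge c d -> a < b -> c < d ->
  L <= a -> b < L + n%:Z -> L <= c -> d < L + n%:Z -> a = c /\ b = d.
Proof.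
move=> /eq_set2[] [] /vtx_window-+ /vtx_window-+ => e1 e2 *.
  by split; [apply: e1 | apply: e2]; lia.
by have := e1; have := e2; lia.
Qed.

Lemma edge_lift L (e : {set 'I_n}) : #|e| = 2%N ->
  exists a b : int, [/\ L <= a, a < b, b < L + n%:Z & e = edge a b].
Proof.
move=> /eqP/cards2P[x [y [neq_xy ->]]].
have [a aL ax] := vtx_lift L x; have [b bL bx] := vtx_lift L y.
case: (ltgtP a b) => [ab|ba|eq_ab].
- by exists a, b; split; rewrite /edge ?ax ?bx //; lia.
- by exists b, a; split; rewrite /edge ?ax ?bx 1?setUC //; lia.
by move: neq_xy; rewrite -ax -bx eq_ab eqxx.
Qed.

Lemma card_edge a b : a < b -> b < a + n%:Z -> #|edge a b| = 2%N.
Proof.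
move=> ab bn; rewrite /edge cards2; case: eqP => // /vtx_window; lia.
Qed.

Lemma external_edge a : edge a (a + 1) \in external n.
Proof. by apply/imsetP; exists (vtx a) => //; rewrite ordS_vtx. Qed.

Lemma external_edge_wrap a : edge a (a + n%:Z - 1) \in external n.
Proof.
have -> : a + n%:Z - 1 = (a - 1) + n%:Z by lia.
by rewrite edgeD -{2}(subrK 1 a) external_edge.
Qed.

Lemma external_edgeE a b : a < b -> b < a + n%:Z ->
  edge a b \in external n -> b = a + 1 \/ b = a + n%:Z - 1.
Proof.
move=> ab bn /imsetP[i _]; have [z za <-] := vtx_lift a i.
rewrite ordS_vtx => /eq_set2[] [] /vtx_near + /vtx_near; lia.
Qed.

Lemma diagonal_edge a b : a + 2 <= b -> b <= a + n%:Z - 2 -> diagonal (edge a b).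
Proof.
move=> ab bn; rewrite /diagonal card_edge ?eqxx; try lia.
by apply/negP => /external_edgeE; lia.
Qed.

Lemma diagonal_lift L (e : {set 'I_n}) : diagonal e ->
  exists a b : int, [/\ L <= a, a + 2 <= b, b < L + n%:Z, b <= a + n%:Z - 2 & e = edge a b].
Proof.
case/andP => /eqP/(edge_lift L)[a [b [La ab bL ->]]] ext.
exists a, b; split=> //; try lia.
- case: (b =P a + 1) => [eqb|]; last lia.
  by rewrite eqb external_edge in ext.
- case: (b =P a + n%:Z - 1) => [eqb|]; last lia.
  by rewrite eqb external_edge_wrap in ext.
Qed.

(** * Crossing edges *)

Lemma crossingC (e f : {set 'I_n}) : crossing e f = crossing f e.
Proof. exact: orbC. Qed.

Lemma alternateI (e f : {set 'I_n}) a b c d :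
  0 <= a -> a < b -> b < c -> c < d -> d < n%:Z ->
  e = edge a c -> f = edge b d -> alternate e f.
Proof.
move=> a0 ab bc cd dn -> ->.
have val z : 0 <= z < n%:Z -> (vtx z : nat)%:Z = z by move=> ?; rewrite val_vtx modz_small.
apply/existsP; exists (vtx a); apply/existsP; exists (vtx b).
apply/existsP; exists (vtx c); apply/existsP; exists (vtx d).
rewrite !eqxx /=; move: (val a) (val b) (val c) (val d); lia.
Qed.

Lemma edge_normal (l : int) : exists q : int, 0 <= l + q * n%:Z < n%:Z.
Proof.
exists (- (l %/ n)%Z); have := modz_ge0 l (isT : n%:Z != 0).
by have := ltz_pmod l (isT : 0 < n%:Z); have := divz_eq l n; lia.
Qed.

(** Crossing is defined through the linear order of the labels 0, ..., n - 1.
After a shift that brings [l] into [0, n), the four cases tell how many of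
[u], [r], [w] have passed n; wrapping those keeps the endpoints alternating. *)
Lemma crossing_edges (l u r w : int) : l < u -> u < r -> r < w -> w < l + n%:Z ->
  crossing (edge l r) (edge u w).
Proof.
move=> lu ur rw wl; have [q ql] := edge_normal l.
rewrite -(edgeDM l r q) -(edgeDM u w q).
set l' := l + _; set u' := u + _; set r' := r + _; set w' := w + _.
have [lu' ur' rw' wl'] : [/\ l' < u', u' < r', r' < w' & w' < l' + n%:Z] by split; lia.
have ql' : 0 <= l' < n%:Z by [].
clearbody l' u' r' w'; clear - ql' lu' ur' rw' wl'.
have wrap a b : edge a b = edge (b - n%:Z) a by rewrite -(edgeD _ (b - n%:Z)) subrK.
have wrap2 a b : edge a b = edge (a - n%:Z) (b - n%:Z) by rewrite /edge !vtxB.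
rewrite /crossing; apply/orP.
have [w_lt|w_ge] := ltP w' n%:Z.
  by left; apply: (alternateI (a := l') (b := u') (c := r') (d := w')) => //; lia.
have [r_lt|r_ge] := ltP r' n%:Z.
  right; apply: (alternateI (a := w' - n%:Z) (b := l') (c := u') (d := r')) => //;
    try lia; exact: wrap.
have [u_lt|u_ge] := ltP u' n%:Z.
  left; apply: (alternateI (a := r' - n%:Z) (b := w' - n%:Z) (c := l') (d := u')) => //;
    try lia; exact: wrap.
right; apply: (alternateI (a := u' - n%:Z) (b := r' - n%:Z) (c := w' - n%:Z)
  (d := l')); try lia.
  exact: wrap2.
exact: wrap.
Qed.

(** Converse of [crossing_edges]: together they make crossing independent of the
point where the polygon is cut open. *)
Lemma crossing_lift (l r : int) (f : {set 'I_n}) :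
  l < r -> r < l + n%:Z -> crossing (edge l r) f ->
  exists u w : int, [/\ l < u, u < r, r < w, w < l + n%:Z & f = edge u w].
Proof.
move=> lr rn.
(* any alternating lift of the four endpoints can be moved onto l and r *)
have key (x y z t : int) : x < y -> y < z -> z < t -> t < x + n%:Z ->
    vtx l = vtx x -> vtx r = vtx z -> f = edge y t ->
    exists u w : int, [/\ l < u, u < r, r < w, w < l + n%:Z & f = edge u w].
  move=> xy yz zt tx /vtx_eq[q eq_l] eq_r eq_f.
  have r_eq : r = z + q * n%:Z by apply: vtx_window; rewrite ?vtxDM //; lia.
  by exists (y + q * n%:Z), (t + q * n%:Z); rewrite edgeDM; split=> //; lia.
case/orP => /existsP[a] /existsP[b] /existsP[c] /existsP[d] /and5P[ab bc cd] /eqP + /eqP +;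
  have dn := ltn_ord d.
- move=> /eq_set2[] [eq_l eq_r] eq_f.
    by apply: (key a b c d); rewrite /edge ?vtx_small //; lia.
  apply: (key c d (a%:Z + n%:Z) (b%:Z + n%:Z)); rewrite /edge ?vtxD ?vtx_small //; try lia.
  by rewrite eq_f setUC.
- move=> eq_f /eq_set2[] [eq_l eq_r].
    apply: (key b c d (a%:Z + n%:Z)); rewrite /edge ?vtxD ?vtx_small //; try lia.
    by rewrite eq_f setUC.
  apply: (key d (a%:Z + n%:Z) (b%:Z + n%:Z) (c%:Z + n%:Z));
    rewrite /edge ?vtxD ?vtx_small //; lia.
Qed.

(** * Triangulations as maximal noncrossing families *)

Lemma noncrossingP (D : {set {set 'I_n}}) :
  reflect ({in D, forall e, diagonal e} /\ {in D &, forall e f, ~~ crossing e f})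
          (noncrossing D).
Proof.
apply: (iffP andP) => -[diagD crossD]; split.
- by move=> e eD; have/forall_inP := diagD; apply.
- by move=> e f eD fD; have/forall_inP/(_ e eD)/forall_inP := crossD; apply.
- by apply/forall_inP.
- by apply/forall_inP => e eD; apply/forall_inP => f fD; apply: crossD.
Qed.

Lemma crossing_self (a b : int) : a < b -> b < a + n%:Z -> ~~ crossing (edge a b) (edge a b).
Proof.
move=> ab bn; apply/negP => /crossing_lift[] // u [w [au ub bw wn]].
by move=> /(edge_window (L := a)); lia.
Qed.

Lemma crossing_external (e f : {set 'I_n}) : e \in external n -> ~~ crossing e f.
Proof.
move=> /imsetP[i _ ->]; have [z _ <-] := vtx_lift 0 i; rewrite ordS_vtx.
by apply/negP => /crossing_lift cross; have [||u [w []]] := cross; lia.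
Qed.

Section Triangulation.

Variable D : {set {set 'I_n}}.
Hypothesis tri_D : triangulation D.

Lemma triangulation_noncrossing : noncrossing D.
Proof. by case/maxsetP: tri_D. Qed.

Lemma triangulation_diagonal : {in D, forall e, diagonal e}.
Proof. by case/noncrossingP: triangulation_noncrossing. Qed.

Lemma triangulation_crossing e f : e \in D :|: external n -> f \in D -> ~~ crossing e f.
Proof.
rewrite inE => /orP[eD|e_ext] fD; last exact: crossing_external.
by have [_] := noncrossingP _ triangulation_noncrossing; apply.
Qed.

Lemma triangulation_maximal e : diagonal e ->
  {in D, forall f, ~~ crossing e f} -> e \in D.
Proof.
move=> diag_e cross_e; have /maxsetP[_ maxD] := tri_D.
rewrite -[D](maxD (e |: D)) ?setU11 ?subsetUr //.
apply/noncrossingP; split=> [f|f g]; rewrite !inE.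
  by case/predU1P => [->//|]; exact: triangulation_diagonal.
have cross_ee: ~~ crossing e e.
  have [a [b [_ ab _ bn ->]]] := diagonal_lift 0 diag_e.
  by apply: crossing_self; lia.
case/predU1P => [->|fD] /predU1P[->|gD].
- exact: cross_ee.
- exact: cross_e.
- by rewrite crossingC; exact: cross_e.
- by apply: triangulation_crossing gD; rewrite inE fD.
Qed.

(** On each side of an edge there is a triangle. Its apex is the last vertex [v]
before [r] that is joined to [l]: a chord crossing the segment from [v] to [r]
would cross one of the edges [l r] and [l v], or join [l] to a later vertex;
so that segment belongs to the family by maximality. *)
Lemma triangulation_apex (l r : int) : l + 2 <= r -> r < l + n%:Z ->
  edge l r \in D :|: external n ->
  exists v : int, [/\ l < v, v < r, edge l v \in D :|: external n
                    & edge v r \in D :|: external n].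
Proof.
move=> lr rn lrD.
pose P i := (l + i.+1%:Z < r) && (edge l (l + i.+1%:Z) \in D :|: external n).
have exP : exists i, P i.
  by exists 0%N; rewrite /P inE external_edge orbT; lia.
have boundP i : P i -> (i <= n)%N by case/andP; lia.
case: (ex_maxnP exP boundP) => i /andP[]; set v := l + _ => vr lvD maxP.
exists v; split=> //; first by lia.
have [v1|v2] := boolP (v + 1 == r).
  by rewrite -(eqP v1) inE external_edge orbT.
rewrite inE triangulation_maximal //; first by apply: diagonal_edge; lia.
move=> e eD; apply/negP => /crossing_lift[]; try lia.
move=> u [w [vu ur rw wn eq_e]]; rewrite {}eq_e in eD.
have := triangulation_crossing lrD eD; have := triangulation_crossing lvD eD.
have [w_lt _ | w_gt | w_eq _ _] := ltgtP w (l + n%:Z).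
- by rewrite crossing_edges //; lia.
- have eq_uw : edge u w = edge (w - n%:Z) u by rewrite edgeC /edge vtxB.
  by rewrite eq_uw crossing_edges //; lia.
rewrite w_eq edgeD in eD.
have := maxP (absz (u - l - 1)%R); rewrite /P.
have -> : l + ((absz (u - l - 1)%R).+1)%:Z = u by lia.
by rewrite inE eD; lia.
Qed.

End Triangulation.

(** * Strips of triangles *)

Definition chord (a : int) (k : nat) := edge a (a + k.+2%:Z).

Lemma chord_window (L a c : int) (i j : nat) : chord a i = chord c j ->
  L <= a -> a + i.+2%:Z < L + n%:Z -> L <= c -> c + j.+2%:Z < L + n%:Z ->
  a = c /\ i = j.
Proof. by move=> /(edge_window (L := L)); lia. Qed.

(** Only the terms of index below n - 3 matter; total sequences avoid carrying
bounds in their type. *)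
Definition stairs (l : nat -> int) :=
  forall k, (k.+1 < n - 3)%N -> l k.+1 = l k \/ l k.+1 = l k - 1.

Definition strip (l : nat -> int) : coloring n := [ffun k : 'I_(n - 3) => chord (l k) k].

Lemma stripE l (k : 'I_(n - 3)) : strip l k = chord (l k) k.
Proof. exact: ffunE. Qed.

Lemma triangle_edge (D : {set {set 'I_n}}) (t e : {set 'I_n}) :
  triangle D t -> e \subset t -> #|e| = 2%N -> e \in D :|: external n.
Proof. by case/andP => _ /forallP/(_ e) + et e2; rewrite et e2; apply. Qed.

(** * Triangles with given vertices *)

Section ThreeVertices.

Variables a b c : int.
Hypotheses (ab : a < b) (bc : b < c) (ca : c < a + n%:Z).

Let t : {set 'I_n} := vtx c |: edge a b.

Lemma card_three : #|t| = 3%N.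
Proof.
rewrite /t cardsU1 card_edge; try lia.
rewrite !inE; case: eqP => [/vtx_window|_]; first lia.
by case: eqP => [/vtx_window|_]; first lia.
Qed.

Lemma edges_of_three (e : {set 'I_n}) : #|e| = 2%N -> e \subset t ->
  e \in [:: edge a b; edge b c; edge a c].
Proof.
move=> /eqP/cards2P[x [y [neq_xy ->]]] /subsetP sub_t.
have := sub_t x (set21 _ _); have := sub_t y (set22 _ _).
rewrite !inE => /or3P[] /eqP eq_y /or3P[] /eqP eq_x.
all: move: neq_xy; rewrite eq_x eq_y ?eqxx //= => _; rewrite /edge.
all: by rewrite ?eqxx ?orbT //= 1?[[set vtx c; _]]setUC
  1?[[set vtx b; vtx a]]setUC ?eqxx ?orbT.
Qed.

Lemma triangle_three (D : {set {set 'I_n}}) :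
  edge a b \in D :|: external n -> edge b c \in D :|: external n ->
  edge a c \in D :|: external n -> triangle D t.
Proof.
move=> abD bcD acD; rewrite /triangle card_three eqxx /=.
apply/forallP => e; apply/implyP => /andP[et /eqP e2].
by have := edges_of_three e2 et; rewrite !inE => /or3P[] /eqP->; rewrite -in_setU.
Qed.

End ThreeVertices.

Lemma edge_neq (x y z u : int) : x < y -> y < x + n%:Z ->
  x <= z -> z < u -> u < x + n%:Z -> (x != z) || (y != u) ->
  (edge x y == edge z u) = false.
Proof. by move=> xy yn xz zu un neq; apply/eqP => /(edge_window (L := x)); lia. Qed.

(** * Colored triangle-free triangulations are strips *)

(** The triangle beyond chord k has an external side, as it does not have three
internal ones, so its apex is next to an endpoint of chord k. Its other internal
side then carries the label k + 1 or k - 1, and k - 1 is taken by the chord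
on the other side. *)
Lemma CTFT_next (T : coloring n) (k k' : 'I_(n - 3)) (a : int) :
  T \in CTFT n -> (k' = k.+1 :> nat) -> T k = chord a k ->
  (forall i : 'I_(n - 3), (k = i.+1 :> nat) -> T i = chord a i \/ T i = chord (a + 1) i) ->
  T k' = chord a k' \/ T k' = chord (a - 1) k'.
Proof.
rewrite inE => /and3P[triT freeT /and3P[/injectiveP injT _ propT]] eq_k' Tk prevT.
have lt_k' := ltn_ord k'.
set D := chords T in triT freeT propT.
have TD i : T i \in D by apply: imset_f.
have diagD := triangulation_diagonal triT.
have [b b_def] : exists b, b = a + k.+2%:Z by exists (a + k.+2%:Z).
have Tk_ab : T k = edge a b by rewrite Tk b_def.
have abD : edge a b \in D by rewrite -Tk_ab TD.
have [ab bn] : a < b /\ b + 3 <= a + n%:Z by clear - b_def lt_k' eq_k'; lia.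
have [w [bw wa bwD waD]] : exists w : int, [/\ b < w, w < a + n%:Z,
    edge b w \in D :|: external n & edge w (a + n%:Z) \in D :|: external n].
  apply: (triangulation_apex triT); try by clear - ab bn; lia.
  by rewrite edgeD inE abD.
rewrite edgeD in waD.
set t := vtx w |: edge a b.
have t3 : triangle D t by apply: triangle_three => //; rewrite inE abD.
have sub_t x y : edge x y \subset t = (vtx x \in t) && (vtx y \in t).
  by rewrite subUset !sub1set.
have at_ : vtx a \in t by rewrite !inE eqxx orbT.
have bt : vtx b \in t by rewrite !inE eqxx !orbT.
have wt : vtx w \in t by rewrite !inE eqxx.
have internalE e : e \in internal_edges D t =
    (e \in D) && (e \in [:: edge a b; edge b w; edge a w]).
  rewrite inE; apply: andb_id2l => eD; apply/idP/idP.
    by apply: edges_of_three => //; have /andP[/eqP] := diagD e eD.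
  by rewrite !inE => /or3P[] /eqP->; rewrite sub_t ?at_ ?bt.
have conclude (a' : int) : a' = a \/ a' = a - 1 ->
    internal_edges D t = [set T k; chord a' k'] -> T k' = chord a' k'.
  move=> a'_a int_t; have neq : T k != chord a' k'.
    apply/eqP; rewrite Tk => /(chord_window (L := a - 1)).
    by clear - lt_k' eq_k' a'_a; lia.
  have := propT; move=> /forallP/(_ t)/implyP; rewrite t3 int_t cards2 neq.
  move=> /(_ isT)/existsP[i /existsP[j /andP[/eqP eq_j /eqP/eq_set2[]]]] [].
    by move=> /injT eq_ki ->; congr (T _); apply/val_inj; rewrite /= eq_j -eq_ki eq_k'.
  (* label k - 1 is the previous chord, on the other side of chord k *)
  move=> /injT eq_kj; rewrite -eq_kj in eq_j => eq_a'.
  have [] := prevT i eq_j; rewrite -eq_a' => /(chord_window (L := a - 1));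
    by clear - lt_k' eq_k' a'_a eq_j; lia.
have [ab_bw ab_aw bw_aw] : [/\ (edge a b == edge b w) = false,
    (edge a b == edge a w) = false & (edge b w == edge a w) = false].
  rewrite [edge b w == _]eq_sym.
  by split; apply: edge_neq; clear - ab bw wa; lia.
have [bwE|bwI] := boolP (edge b w \in D); last first.
  left; apply: conclude; first by left.
  have w_b : w = b + 1.
    move: bwD; rewrite inE (negPf bwI) => /external_edgeE.
    by clear - bw wa bn ab; lia.
  have awD : edge a w \in D.
    move: waD; rewrite inE => /orP[//|/external_edgeE].
    by clear - w_b bn ab; lia.
  apply/setP => e; rewrite internalE !inE Tk_ab.
  have -> : chord a k' = edge a w.
    by rewrite /chord w_b b_def eq_k'; congr edge; clear; lia.
  have [->|] := eqVneq e (edge a b); first by rewrite abD.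
  have [->|] := eqVneq e (edge b w); first by rewrite (negPf bwI) bw_aw.
  by have [->|] := eqVneq e (edge a w); rewrite ?awD ?andbF.
have awI : edge a w \notin D.
  apply/negP => awD; move/forallP/(_ t)/implyP/(_ t3)/negP: freeT; apply.
  have -> : internal_edges D t = edge b w |: [set edge a b; edge a w].
    apply/setP => e; rewrite internalE !inE orbCA.
    by apply/andb_idl => /or3P[] /eqP->.
  by rewrite cardsU1 cards2 !inE [edge b w == edge a b]eq_sym ab_bw bw_aw ab_aw.
right; apply: conclude; first by right.
have w_a : w = a + n%:Z - 1.
  move: waD; rewrite inE (negPf awI) => /external_edgeE.
  by clear - bw wa ab; lia.
apply/setP => e; rewrite internalE !inE Tk_ab.
have -> : chord (a - 1) k' = edge b w.
  rewrite /chord -edgeD w_a b_def eq_k'.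
  by congr edge; clear; lia.
have [->|] := eqVneq e (edge a b); first by rewrite abD.
have [->|] := eqVneq e (edge b w); first by rewrite bwE.
by have [->|] := eqVneq e (edge a w); rewrite ?(negPf awI) ?andbF.
Qed.

(** The lift of the short chord 0 fixes the lifts of all the others, one after the
other. *)
Lemma CTFT_strip (T : coloring n) : T \in CTFT n -> exists2 l, stairs l & T = strip l.
Proof.
move=> T_CTFT.
have [z T0] : exists z, forall k : 'I_(n - 3), (k = 0 :> nat)%N -> T k = chord z k.
  move: T_CTFT; rewrite inE => /and3P[_ _ /and3P[_ + _]].
  case/existsP=> k0 /andP[/eqP k0_0 /existsP[i /eqP Tk0]].
  have [z _ eq_i] := vtx_lift 0 i; exists (z - 1) => k k_0.
  have -> : k = k0 by apply: val_inj; rewrite /= k_0 k0_0.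
  rewrite Tk0 -eq_i ordS_vtx ord_pred_vtx /chord k0_0.
  by congr [set _; vtx _]; lia.
suff ext k : (k < n - 3)%N -> exists l : nat -> int,
    (forall j, (j < k)%N -> l j.+1 = l j \/ l j.+1 = l j - 1) /\
    (forall j : 'I_(n - 3), (j <= k)%N -> T j = chord (l j) j).
  have [|l [stairs_l Tl]] := ext (n - 4)%N; first by lia.
  exists l => [k lt_k|]; first by apply: stairs_l; lia.
  by apply/ffunP => k; rewrite stripE Tl //; have := ltn_ord k; lia.
elim: k => [|k IH] lt_k.
  by exists (fun=> z); split=> // j; rewrite leqn0 => /eqP; apply: T0.
have [l [stairs_l Tl]] := IH (ltnW lt_k).
pose kk := Ordinal (ltnW lt_k); pose k' := Ordinal lt_k.
have extend a' : a' = l k \/ a' = l k - 1 -> T k' = chord a' k' ->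
    exists l : nat -> int, (forall j, (j < k.+1)%N -> l j.+1 = l j \/ l j.+1 = l j - 1) /\
    (forall j : 'I_(n - 3), (j <= k.+1)%N -> T j = chord (l j) j).
  move=> a'E Tk'; exists (fun j => if j == k.+1 then a' else l j); split=> j lt_j.
    rewrite eqSS (_ : j == k.+1 = false); last by lia.
    by have [->//|neq_j] := eqVneq j k; apply: stairs_l; lia.
  have [eq_j|neq_j] := eqVneq (j : nat) k.+1; last by apply: Tl; lia.
  by rewrite (_ : j = k') //; apply: val_inj.
have [|//|i eq_i| |] := @CTFT_next T kk k' (l k) T_CTFT; first by [].
- exact: (Tl kk).
- rewrite /= in eq_i; rewrite Tl; last by lia.
  by have := stairs_l i; rewrite -eq_i => /(_ (leqnn _))[] ->; [left | right; rewrite subrK].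
- by apply: extend; left.
- by apply: extend; right.
Qed.

(** * Strips are colored triangle-free triangulations *)

(** The intervals of the chords are nested. *)
Lemma stairs_bounds l (i j : nat) : stairs l -> (i <= j)%N -> (j < n - 3)%N ->
  l j <= l i <= l j + j%:Z - i%:Z.
Proof.
move=> stairs_l; elim: j => [|j IH]; first by rewrite leqn0 => /eqP->; lia.
rewrite leq_eqVlt => /predU1P[->|]; first by lia.
rewrite ltnS => lt_ij lt_j; have := IH lt_ij (ltnW lt_j).
have := stairs_l j lt_j; lia.
Qed.

(** The interval of the last chord contains all the vertices but one, so its left
end starts a window of n consecutive integers in which all chords have lifts. *)
Lemma strip_window l k : stairs l -> (k < n - 3)%N ->
  l (n - 4)%N <= l k /\ l k + k.+2%:Z <= l (n - 4)%N + n%:Z - 2.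
Proof.
move=> stairs_l lt_k; have := @stairs_bounds l k (n - 4) stairs_l; lia.
Qed.

Lemma chord_inj l (i j : nat) : stairs l -> (i < n - 3)%N -> (j < n - 3)%N ->
  chord (l i) i = chord (l j) j -> i = j.
Proof.
move=> stairs_l lt_i lt_j; have := strip_window stairs_l lt_i.
have := strip_window stairs_l lt_j => ? ?.
by move=> /(chord_window (L := l (n - 4)%N)); lia.
Qed.

Lemma strip_inj l : stairs l -> injective (strip l).
Proof.
by move=> stairs_l i j; rewrite !stripE => /chord_inj eq_ij; apply/val_inj/eq_ij.
Qed.

Lemma chord_diagonal a k : (k < n - 3)%N -> diagonal (chord a k).
Proof. by move=> lt_k; apply: diagonal_edge; lia. Qed.

Lemma strip_noncrossing l (i j : nat) : stairs l -> (i < n - 3)%N -> (j < n - 3)%N ->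
  ~~ crossing (chord (l i) i) (chord (l j) j).
Proof.
move=> stairs_l; wlog le_ij : i j / (i <= j)%N => [wl lt_i lt_j|lt_i lt_j].
  by have /orP[] := leq_total i j => le_ij; last rewrite crossingC; apply: wl.
rewrite crossingC; apply/negP => /crossing_lift[]; try by clear - lt_j; lia.
move=> u [w [lu ur rw wl eq_uw]].
have bnd := stairs_bounds stairs_l le_ij lt_j.
have := edge_window (L := l j) eq_uw.
by clear - le_ij lt_j lu ur rw wl bnd; lia.
Qed.

(** Take the first chord whose interval contains both ends of the diagonal. One end
is the vertex that this chord adds, and unless the diagonal is that chord
itself, it crosses the previous chord. A diagonal that fits in no interval ends
at the vertex outside that of the last chord, and crosses the last chord. *)
Lemma strip_maximal l (a b : int) : stairs l -> diagonal (edge a b) ->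
  (forall k, (k < n - 3)%N -> ~~ crossing (chord (l k) k) (edge a b)) ->
  exists2 k, (k < n - 3)%N & edge a b = chord (l k) k.
Proof.
move=> stairs_l diag_ab nocross.
have inside k (c d : int) : (k < n - 3)%N -> edge a b = edge c d ->
    l k <= c -> c + 2 <= d -> d <= l k + k.+2%:Z ->
    exists2 k, (k < n - 3)%N & edge a b = chord (l k) k.
  elim: k => [|k IH] lt_k eq_cd lc cd dr.
    have [c0 d0] : c = l 0%N /\ d = l 0%N + 2%:Z by clear - lc cd dr; lia.
    by exists 0%N; rewrite ?eq_cd ?c0 ?d0.
  have step := stairs_l k lt_k; have lt_k' := ltnW lt_k.
  have [in_k|out_k] := boolP ((l k <= c) && (d <= l k + k.+2%:Z)).
    by case/andP: in_k => ? ?; apply: IH.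
  have nc := nocross k lt_k'.
  have [whole|not_whole] := boolP ((c == l k.+1) && (d == l k.+1 + k.+3%:Z)).
    by case/andP: whole => /eqP eq_c /eqP eq_d; exists k.+1; rewrite // eq_cd eq_c eq_d.
  exfalso; move/negP: nc; apply; rewrite eq_cd /chord.
  have [c_out|c_in] := ltP c (l k).
    by rewrite -[edge c d]edgeD crossing_edges //;
      clear - lt_k step lc cd dr out_k not_whole c_out; lia.
  by apply: crossing_edges; clear - lt_k step lc cd dr out_k not_whole c_in; lia.
have [c [d [Lc cd dL dc eq_cd]]] := diagonal_lift (l (n - 4)%N) diag_ab.
set L := l (n - 4)%N in Lc dL *; have lt_last : (n - 4 < n - 3)%N by lia.
have [in_L|out_L] := lerP d (L + n%:Z - 2).
  by apply: (inside (n - 4)%N c d); rewrite // -/L; clear - cd Lc in_L; lia.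
exfalso; move/negP: (nocross (n - 4)%N lt_last); apply; rewrite eq_cd.
by apply: crossing_edges; rewrite -/L; clear - Lc cd dL dc out_L; lia.
Qed.

Lemma strip_triangulation l : stairs l -> triangulation (chords (strip l)).
Proof.
move=> stairs_l.
have chordP e : reflect (exists2 k, (k < n - 3)%N & e = chord (l k) k) (e \in chords (strip l)).
  apply: (iffP imsetP) => [[k _ ->]|[k lt_k ->]]; last first.
    by exists (Ordinal lt_k); rewrite ?stripE.
  by exists k; rewrite ?stripE.
apply/maxsetP; split=> [|D /noncrossingP[diagD crossD] subD].
  apply/noncrossingP; split=> [e|e f] /chordP[k lt_k ->]; first exact: chord_diagonal.
  by move=> /chordP[j lt_j ->]; apply: strip_noncrossing.
apply/eqP; rewrite eqEsubset subD andbT; apply/subsetP => e eD; apply/chordP.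
have diag_e := diagD e eD; have [a [b [_ _ _ _ eq_e]]] := diagonal_lift 0 diag_e.
rewrite eq_e in diag_e eD *; apply: strip_maximal => // k lt_k.
by apply: crossD => //; apply: (subsetP subD); apply/chordP; exists k.
Qed.

(** Two chords of one triangle share an endpoint, by counting vertices. The third
side lies between their other ends. If it is external, the lengths of the two
chords differ by 1, and so do their labels. It cannot be a chord: nested chords
never meet end to end. *)
Lemma strip_triangle l (t : {set 'I_n}) (i k : 'I_(n - 3)) : stairs l ->
  triangle (chords (strip l)) t -> strip l i \subset t -> strip l k \subset t ->
  (i < k)%N -> (k = i.+1 :> nat).
Proof.
move=> stairs_l t3; rewrite !stripE => it kt lt_ik; have lt_k := ltn_ord k.
have card_t : #|t| = 3%N by case/andP: t3 => /eqP.
have bnd := stairs_bounds stairs_l (ltnW lt_ik) lt_k.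
have third (a b : int) : a < b -> b < a + n%:Z -> vtx a \in t -> vtx b \in t ->
    edge a b \in external n \/ exists2 j : 'I_(n - 3), True & edge a b = chord (l j) j.
  move=> ab bn at_ bt.
  have : edge a b \in chords (strip l) :|: external n.
    by apply: (triangle_edge t3); rewrite ?subUset ?sub1set ?at_ ?bt ?card_edge.
  rewrite inE => /orP[/imsetP[j _ ->]|]; last by left.
  by right; exists j; rewrite ?stripE.
have mem_t a b c : edge a b \subset t -> c = a \/ c = b -> vtx c \in t.
  by move=> /subsetP sub_t [] ->; apply: sub_t; rewrite !inE eqxx ?orbT.
have li := mem_t _ _ (l i) it (or_introl erefl).
have ri := mem_t _ _ (l i + i.+2%:Z) it (or_intror erefl).
have lk := mem_t _ _ (l k) kt (or_introl erefl).
have rk := mem_t _ _ (l k + k.+2%:Z) kt (or_intror erefl).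
have [l_eq|l_neq] := eqVneq (l i) (l k).
  have [||||ext|[j _ eq_j]] := third (l i + i.+2%:Z) (l k + k.+2%:Z); 
     rewrite ?ri ?rk //; try by clear - lt_ik lt_k l_eq; lia.
    by move/external_edgeE: ext; clear - lt_ik lt_k l_eq; lia.
  exfalso; have lt_j := ltn_ord j.
  have := @stairs_bounds l i j stairs_l; have := @stairs_bounds l j i stairs_l.
  have := leq_total i j.
  have := strip_window stairs_l lt_j; have := strip_window stairs_l lt_k.
  have := edge_window (L := l (n - 4)%N) eq_j.
  have := ltn_ord i.
  clear - lt_ik lt_k l_eq lt_j; lia.
have [r_eq|r_neq] := eqVneq (l i + i.+2%:Z) (l k + k.+2%:Z).
  have [||||ext|[j _ eq_j]] := third (l k) (l i); 
     rewrite ?li ?lk //; try by clear - bnd lt_ik lt_k l_neq; lia.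
    by move/external_edgeE: ext; clear - lt_ik lt_k l_neq r_eq; lia.
  exfalso; have lt_j := ltn_ord j.
  have := @stairs_bounds l i j stairs_l; have := @stairs_bounds l j i stairs_l.
  have := leq_total i j.
  have := strip_window stairs_l lt_j; have := strip_window stairs_l lt_k.
  have := edge_window (L := l (n - 4)%N) eq_j.
  have := ltn_ord i.
  clear - lt_ik lt_k l_neq r_eq lt_j; lia.
exfalso.
have disj : chord (l i) i :&: chord (l k) k = set0.
  apply/setP => x; rewrite !inE; apply/negP.
  by case/andP => /orP[] /eqP-> /orP[] /eqP/vtx_window; clear - bnd lt_ik lt_k l_neq r_neq; lia.
have := subset_leq_card (_ : chord (l i) i :|: chord (l k) k \subset t).
rewrite subUset it kt card_t cardsU disj cards0 !card_edge => [/(_ isT)||||] //.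
all: by clear - lt_ik lt_k; lia.
Qed.

Lemma strip_triangle_consecutive l (t : {set 'I_n}) (i k : 'I_(n - 3)) : stairs l ->
  triangle (chords (strip l)) t -> strip l i \subset t -> strip l k \subset t ->
  i != k -> (k = i.+1 :> nat) \/ (i = k.+1 :> nat).
Proof.
move=> stairs_l t3 it kt; rewrite neq_ltn => /orP[lt_ik|lt_ki].
  by left; apply: (strip_triangle stairs_l t3).
by right; apply: (strip_triangle stairs_l t3).
Qed.

Lemma internal_edgesP (T : coloring n) (t e : {set 'I_n}) :
  e \in internal_edges (chords T) t -> exists2 k, e = T k & T k \subset t.
Proof. by rewrite inE => /andP[/imsetP[k _ ->] kt]; exists k. Qed.

(** [strip_triangle_consecutive] gives the color condition, and also excludes
triangles with three chords: of three labels, two differ by more than 1. *)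
Lemma strip_CTFT l : stairs l -> strip l \in CTFT n.
Proof.
move=> stairs_l; rewrite inE strip_triangulation //=; apply/andP; split.
  apply/forallP => t; apply/implyP => t3; apply/negP => /eqP card3.
  have /card_gt2P[x [y [z [[]]]]] : (2 < #|internal_edges (chords (strip l)) t|)%N by rewrite card3.
  move=> /internal_edgesP[i -> it] /internal_edgesP[j -> jt] /internal_edgesP[k -> kt].
  rewrite !(inj_eq (strip_inj stairs_l)) => -[neq_ij neq_jk neq_ki].
  have := strip_triangle_consecutive stairs_l t3 it jt neq_ij.
  have := strip_triangle_consecutive stairs_l t3 jt kt neq_jk.
  have := strip_triangle_consecutive stairs_l t3 kt it neq_ki.
  by clear; lia.
apply/and3P; split.
- exact/injectiveP/strip_inj.
- have lt_0 : (0 < n - 3)%N by [].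
  apply/existsP; exists (Ordinal lt_0); rewrite stripE eqxx /=.
  apply/existsP; exists (vtx (l 0%N + 1)); rewrite ord_pred_vtx ordS_vtx /chord /edge.
  by apply/eqP; congr [set vtx _; vtx _]; clear; lia.
apply/forallP => t; apply/implyP => /andP[t3 /cards2P[x [y [neq_xy int_t]]]].
have /internal_edgesP[i eq_i it] : x \in internal_edges (chords (strip l)) t.
  by rewrite int_t set21.
have /internal_edgesP[j eq_j jt] : y \in internal_edges (chords (strip l)) t.
  by rewrite int_t set22.
have neq_ij : i != j by apply: contra_neq neq_xy => eq_ij; rewrite eq_i eq_j eq_ij.
have [] := strip_triangle_consecutive stairs_l t3 it jt neq_ij => [ji|ij].
  by apply/existsP; exists i; apply/existsP; exists j; rewrite ji int_t eq_i eq_j !eqxx.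
by apply/existsP; exists j; apply/existsP; exists i; rewrite ij int_t eq_i eq_j setUC !eqxx.
Qed.

(** * Flips move one term of the sequence by one *)

(** Nearby lifts of a chord agree even when the chord is a diameter, whose lifts
are only determined up to n / 2: that is more than 2 as n > 4. *)
Lemma chord_near (a b : int) k : (k < n - 3)%N -> - 2 <= a - b <= 2 ->
  chord a k = chord b k -> a = b.
Proof.
move=> lt_k ab /eq_set2[] [] /vtx_near + /vtx_near; clear - lt_k ab; lia.
Qed.

(** For lengths 2 and n - 2, a chord and its complement could only be confused if
n divided 4. *)
Lemma mul_size_neq4 (q : int) : q * n%:Z <> 4.
Proof. by have [?|?] := lerP q 0; nia. Qed.

Lemma chord_first (a b : int) : chord a 0 = chord b 0 -> exists q : int, a = b + q * n%:Z.
Proof.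
case/eq_set2=> [] [] /vtx_eq[q eq_q] /vtx_eq[q' eq_q']; first by exists q.
by exfalso; have := @mul_size_neq4 (q' - q); rewrite mulrBl; clear - eq_q eq_q'; lia.
Qed.

Lemma chord_last (a b : int) :
  chord a (n - 4) = chord b (n - 4) -> exists q : int, a = b + q * n%:Z.
Proof.
case/eq_set2=> [] [] /vtx_eq[q eq_q] /vtx_eq[q' eq_q']; first by exists q.
exfalso; have := @mul_size_neq4 (2 - q' + q); rewrite mulrDl mulrBl; clear - eq_q eq_q'; lia.
Qed.

Lemma chordDM (a q : int) k : chord (a + q * n%:Z) k = chord a k.
Proof. by rewrite /chord addrAC edgeDM. Qed.

Lemma stairsD l (c : int) : stairs l -> stairs (fun k => l k + c).
Proof. by move=> stairs_l k /stairs_l[] ->; [left | right]; rewrite // addrAC. Qed.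

Lemma stripDM l (q : int) : strip (fun k => l k + q * n%:Z) = strip l.
Proof. by apply/ffunP => k; rewrite !stripE chordDM. Qed.

(** The geometry of the flip is not used: a second strip with the same chords
except at label k must be close to the first. Fix its lift at an end of the
label range other than k, where lifts are unique up to n; [chord_near] carries
the agreement along the range, across k, as two steps change the difference of
the two sequences by at most 2. *)
Lemma strip_step l (U : coloring n) (k : 'I_(n - 3)) : stairs l -> U \in CTFT n ->
  (forall j, j != k -> U j = strip l j) ->
  exists l', [/\ stairs l', U = strip l', - 1 <= l' k - l k <= 1 &
    forall j, (j < n - 3)%N -> j != k -> l' j = l j].
Proof.
move=> stairs_l /CTFT_strip[l0 stairs_l0 ->] eq_U.
have {}eq_U (j : nat) : (j < n - 3)%N -> j != k -> chord (l0 j) j = chord (l j) j.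
  by move=> lt_j neq_j; have := eq_U (Ordinal lt_j) neq_j; rewrite !stripE.
have lt_k := ltn_ord k.
have [k_0|k_gt0] := posnP k.
  (* start from the last label and go down *)
  have lt_last : (n - 4 < n - 3)%N by lia.
  have last_k : (n - 4)%N != k by rewrite k_0.
  have [q eq_q] := chord_last (eq_U _ lt_last last_k).
  exists (fun j => l0 j + (- q) * n%:Z); rewrite stripDM.
  have stairs_l' := stairsD (- q * n%:Z) stairs_l0.
  set l' := fun j => _ in stairs_l' *.
  have claim (i : nat) : (i < n - 3)%N -> (i < n - 4 -> l' (n - 4 - i)%N = l (n - 4 - i)%N)%N
    /\ - 1 <= l' (n - 4 - i)%N - l (n - 4 - i)%N <= 1.
    elim: i => [|i IH] lt_i; first by rewrite subn0 /l' eq_q; clear; split; lia.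
    have [eq_i near_i] := IH (ltnW lt_i).
    have eq_pred : (n - 4 - i)%N = (n - 4 - i.+1).+1 by clear - lt_i; lia.
    have lt_pred : ((n - 4 - i.+1).+1 < n - 3)%N by clear - lt_i; lia.
    have := stairs_l' _ lt_pred; have := stairs_l _ lt_pred.
    rewrite -eq_pred => step step'; move: eq_i => /(_ lt_i) eq_i.
    split=> [lt_i'|]; last by clear - eq_i step step'; lia.
    apply: (chord_near (ltnW lt_pred)); first by clear - eq_i step step'; lia.
    rewrite chordDM; apply: eq_U; first exact: ltnW.
    by rewrite k_0; clear - lt_i'; lia.
  split=> // [|j lt_j neq_j].
    have [] := claim (n - 4)%N lt_last; rewrite subnn k_0 //.
  have [] := claim (n - 4 - j)%N; first by clear - lt_j; lia.
  rewrite subKn ; last by clear - lt_j; lia.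
  by move=> eq_j _; apply: eq_j; move: neq_j; rewrite k_0; clear - lt_j; lia.
(* start from label 0 and go up *)
have neq_0 : 0%N != k by rewrite neq_ltn k_gt0.
have [q eq_q] := chord_first (eq_U _ (leq_ltn_trans (leq0n _) lt_k) neq_0).
exists (fun j => l0 j + (- q) * n%:Z); rewrite stripDM.
have stairs_l' := stairsD (- q * n%:Z) stairs_l0.
set l' := fun j => _ in stairs_l' *.
have claim (j : nat) : (j < n - 3)%N -> (j != k -> l' j = l j) /\ - 1 <= l' j - l j <= 1.
  elim: j => [|j IH] lt_j; first by rewrite /l' eq_q; clear; split; lia.
  have [eq_j near_j] := IH (ltnW lt_j).
  have := stairs_l' _ lt_j; have := stairs_l _ lt_j => step step'.
  have eq_j1 : j.+1 != k -> l' j.+1 = l j.+1.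
    move=> neq_j; apply: (chord_near lt_j); first by clear - near_j step step'; lia.
    by rewrite chordDM; apply: eq_U.
  split=> //; have [eq_k|neq_k] := eqVneq j.+1 k; last by rewrite eq_j1 // subrr.
  by move: step step'; rewrite eq_j; [clear; lia | rewrite -eq_k; clear; lia].
split=> // [|j lt_j neq_j]; first by have [] := claim k lt_k.
by have [eq_j _] := claim j lt_j; apply: eq_j.
Qed.

Lemma flip_other (T U : coloring n) k : flip k T U -> forall j, j != k -> U j = T j.
Proof.
case/existsP => t1 /existsP[t2 /and5P[_ _ _ _ /andP[_ /eqP->]]] j neq_j.
by rewrite ffunE (negPf neq_j).
Qed.

Lemma flip_self (T U : coloring n) k : flip k T U -> T k != set0 -> U k != T k.
Proof.
case/existsP => t1 /existsP[t2 /and5P[_ _ _ _ /andP[_ /eqP->]]].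
rewrite ffunE eqxx => Tk_neq0; apply: contra_neq Tk_neq0 => eq_Tk.
by rewrite -[T k]setIid -{1}eq_Tk setIDAC setDIl setDv setI0.
Qed.

Lemma strip_neq0 l k : strip l k != set0.
Proof. by rewrite stripE; apply/set0Pn; exists (vtx (l k)); rewrite set21. Qed.

Lemma flip_graph_step (T U : coloring n) : flip_graph T U ->
  [/\ T \in CTFT n, U \in CTFT n & exists2 k, U k != T k & forall j, j != k -> U j = T j].
Proof.
case/and3P => T_CTFT U_CTFT /existsP[k flip_k]; split=> //; exists k.
  have [l _ eq_T] := CTFT_strip T_CTFT; have [l' _ eq_U] := CTFT_strip U_CTFT.
  case/orP: flip_k => /flip_self; first by apply; rewrite eq_T strip_neq0.
  by move=> neq; rewrite eq_sym; apply: neq; rewrite eq_U strip_neq0.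
by move=> j neq_j; case/orP: flip_k => /flip_other -> //.
Qed.

Lemma CTFT_inj (T : coloring n) : T \in CTFT n -> injective T.
Proof. by case/CTFT_strip=> l stairs_l ->; apply: strip_inj. Qed.

Lemma flipped_step (T U : coloring n) k d : T \in CTFT n -> U k != T k ->
  (forall j, j != k -> U j = T j) -> flipped d T U = (d == T k).
Proof.
move=> /CTFT_inj injT neq_k eq_j; apply/andP/eqP => [[/imsetP[j _ ->]] dU|->].
  have [-> //|neq_jk] := eqVneq j k.
  by case/negP: dU; rewrite -eq_j //; apply: imset_f.
split; first exact: imset_f.
apply/negP => /imsetP[j _ eq_Tk]; have [eq_jk|neq_jk] := eqVneq j k.
  by move: neq_k; rewrite -eq_jk -eq_Tk eq_jk eqxx.
by rewrite eq_j // in eq_Tk; rewrite (injT _ _ eq_Tk) eqxx in neq_jk.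
Qed.

(** * Every diagonal is flipped on every path to the reversal *)

(** A discrete intermediate value theorem for each label: a value that is left in
the direction of the endpoint is a chord that is erased. *)
Lemma path_cover p l : stairs l -> path (@flip_graph n) (strip l) p ->
  exists2 z, stairs z & last (strip l) p = strip z /\
    forall k a, (k < n - 3)%N -> (l k <= a < z k) || (z k < a <= l k) ->
      (0 < flip_count (chord a k) (strip l) p)%N.
Proof.
elim: p l => [|U p IH] l stairs_l /=.
  by move=> _; exists l => //; split=> // k a _; lia.
case/andP => /flip_graph_step[T_CTFT U_CTFT [k neq_k eq_j]].
have [l' [stairs_l' eq_U step_k eq_l']] := strip_step stairs_l U_CTFT eq_j.
rewrite {1 2}eq_U => path_p; have [z stairs_z [eq_z cover]] := IH l' stairs_l' path_p.
exists z => //; split=> // i a lt_i between.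
rewrite /flip_count /= addn_gt0 (flipped_step _ T_CTFT neq_k eq_j).
have [->|] //= := eqVneq (chord a i) (strip l k); rewrite stripE => neq_a.
rewrite eq_U; apply: cover => //.
have [eq_ik|/eq_l' -> //] := eqVneq i (k : nat).
have {}neq_a : a != l k by apply: contra_neq neq_a => ->; rewrite eq_ik.
by rewrite eq_ik in between *; clear - between step_k neq_a; lia.
Qed.

Lemma strip_eq l l' : stairs l -> stairs l' -> strip l = strip l' ->
  exists q : int, forall k, (k < n - 3)%N -> l k = l' k + q * n%:Z.
Proof.
move=> stairs_l stairs_l' eq_strip.
have eq_chord k : (k < n - 3)%N -> chord (l k) k = chord (l' k) k.
  by move=> lt_k; have /ffunP/(_ (Ordinal lt_k)) := eq_strip; rewrite !stripE.
have lt_0 : (0 < n - 3)%N by [].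
have [q eq_q] := chord_first (eq_chord _ lt_0); exists q.
elim=> [//|k IH] lt_k; apply: (chord_near lt_k); last by rewrite chordDM eq_chord.
have := IH (ltnW lt_k); have := stairs_l k lt_k; have := stairs_l' k lt_k.
by clear; lia.
Qed.

(** Chord n - 4 - k seen from its other side: it then starts at its former right
end, which is [l (n - 4 - k) - (k + 2)] modulo n. *)
Definition opposite (l : nat -> int) k : int := l (n - 4 - k)%N - k.+2%:Z.

Lemma stairs_opposite l : stairs l -> stairs (opposite l).
Proof.
move=> stairs_l k lt_k; rewrite /opposite.
have eq_k : (n - 4 - k)%N = (n - 4 - k.+1).+1 by clear - lt_k; lia.
have := stairs_l (n - 4 - k.+1)%N; rewrite -eq_k.
move=> /(_ _)[]; first by clear - lt_k; lia.
  by clear; lia.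
by clear; lia.
Qed.

Lemma reversal_strip l : reversal (strip l) = strip (opposite l).
Proof.
apply/ffunP => k; rewrite ffunE !stripE /opposite /=; have lt_k := ltn_ord k.
have -> : (n - 3 - k.+1)%N = (n - 4 - k)%N by clear; lia.
rewrite /chord -[RHS]edgeD subrK.
by congr edge; clear - lt_k; lia.
Qed.

(** A diagonal has two lifts as a chord, one of length k + 2 and the other of length
k' + 2 with k' = n - 4 - k. Normalize the first one to start in the n integers
next to [l k], above or below according to the direction of the path; if label
k does not reach it, label k' leaves the second one. *)
Lemma every_diagonal_flipped l p d : stairs l -> path (@flip_graph n) (strip l) p ->
  last (strip l) p = reversal (strip l) -> diagonal d -> (0 < flip_count d (strip l) p)%N.
Proof.
move=> stairs_l path_p last_p diag_d.
have [z stairs_z [eq_z cover]] := path_cover stairs_l path_p.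
have [||q eq_q] := @strip_eq z (opposite l) stairs_z; first exact: stairs_opposite.
  by rewrite -eq_z last_p reversal_strip.
have [a [b [_ ab _ ba eq_d]]] := diagonal_lift 0 diag_d.
pose k := absz (b - a - 2)%R; have b_eq : b = a + k.+2%:Z by rewrite /k; clear - ab; lia.
have lt_k : (k < n - 3)%N by rewrite /k; clear - ab ba; lia.
pose k' := (n - 4 - k)%N; have lt_k' : (k' < n - 3)%N by rewrite /k'; clear; lia.
have eq_k : (n - 4 - k')%N = k by rewrite /k'; clear - lt_k; lia.
clearbody k.
have d_k c : vtx c = vtx a -> d = chord c k.
  by move/vtx_eq=> [r ->]; rewrite chordDM eq_d b_eq.
have d_k' c : vtx c = vtx b -> d = chord c k'.
  move/vtx_eq=> [r ->]; rewrite chordDM eq_d -[LHS]edgeD /chord.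
  by congr edge; rewrite b_eq /k'; clear - lt_k; lia.
have cover_k c : vtx c = vtx a -> (l k <= c < z k) || (z k < c <= l k) ->
    (0 < flip_count d (strip l) p)%N.
  by move=> /d_k ->; apply: cover.
have cover_k' c : vtx c = vtx b -> (l k' <= c < z k') || (z k' < c <= l k') ->
    (0 < flip_count d (strip l) p)%N.
  by move=> /d_k' ->; apply: cover.
have zk := eq_q k lt_k; have zk' := eq_q k' lt_k'.
rewrite /opposite -/k' in zk; rewrite /opposite eq_k in zk'.
have k'_def : k'%:Z = n%:Z - 4 - k%:Z by rewrite /k'; clear - lt_k; lia.
have [q_gt0|q_le0] := ltrP 0 q.
  have qn : n%:Z <= q * n%:Z by rewrite -{1}[n%:Z]mul1r ler_wpM2r.
  have [c c_win eq_c] := vtx_lift (l k) (vtx a).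
  have [c_lt|c_ge] := ltrP c (l k' - k.+2%:Z + n%:Z).
    by apply: (cover_k c) => //; clear - c_win c_lt qn zk; lia.
  apply: (cover_k' (c + k.+2%:Z - n%:Z)).
    by rewrite vtxB b_eq; have [r ->] := vtx_eq eq_c; rewrite addrAC vtxDM.
  by clear - c_win c_ge qn zk' k'_def; lia.
have qn : q * n%:Z <= 0 by rewrite mulr_le0_ge0.
have [c c_win eq_c] := vtx_lift (l k - n%:Z + 1) (vtx a).
have [c_gt|c_le] := ltrP (l k' - k.+2%:Z) c.
  by apply: (cover_k c) => //; clear - c_win c_gt qn zk; lia.
apply: (cover_k' (c + k.+2%:Z)).
  by rewrite b_eq; have [r ->] := vtx_eq eq_c; rewrite addrAC vtxDM.
by clear - c_win c_le qn zk' k'_def; lia.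
Qed.

(** The term k can be raised only if chord k - 1 (for k = 0, the external edge)
is [l k + 1, r] and chord k + 1 (or the external edge) is [l k, r + 1], with
[r = l k + k + 2]: the quadrangle around chord k is [l k, l k + 1, r, r + 1]. *)
Lemma strip_raise l l' (k : 'I_(n - 3)) : stairs l -> stairs l' -> l' k = l k + 1 ->
  (forall j, (j < n - 3)%N -> j != k -> l' j = l j) -> flip_graph (strip l) (strip l').
Proof.
move=> stairs_l stairs_l' up same; rewrite /flip_graph !strip_CTFT //=.
apply/existsP; exists k; apply/orP; left; have lt_k := ltn_ord k.
set D := chords (strip l).
have chordD (j : nat) : (j < n - 3)%N -> chord (l j) j \in D.
  by move=> lt_j; apply/imsetP; exists (Ordinal lt_j); rewrite ?stripE.
pose a := l k; pose b := a + k.+2%:Z.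
have inner : edge (a + 1) b \in D :|: external n.
  rewrite inE; have [k_0|k_gt0] := posnP k.
    by rewrite /b k_0 (_ : a + 2%:Z = a + 1 + 1) ?external_edge ?orbT //; clear; lia.
  have [j eq_j] : exists j, k = j.+1 :> nat by exists k.-1; rewrite prednK.
  have lt_j : (j.+1 < n - 3)%N by rewrite -eq_j.
  have neq_j : j != k by rewrite eq_j; clear; lia.
  have := stairs_l j lt_j; have := stairs_l' j lt_j; rewrite -eq_j up same ?(ltnW lt_j) //.
  move=> step' step; rewrite (_ : edge _ _ = chord (l j) j) ?chordD ?(ltnW lt_j) //.
  have -> : l j = a + 1 by rewrite /a; clear - step step'; lia.
  by rewrite /chord /b eq_j; congr edge; clear; lia.
have outer : edge a (b + 1) \in D :|: external n.
  rewrite inE; have [last_k|lt_j] := leqP (n - 3) k.+1.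
    have -> : b + 1 = a + n%:Z - 1 by rewrite /b; clear - last_k lt_k; lia.
    by rewrite external_edge_wrap orbT.
  have neq_j : k.+1 != k by clear; lia.
  have := stairs_l k lt_j; have := stairs_l' k lt_j; rewrite up same //.
  move=> step' step; rewrite (_ : edge _ _ = chord (l k.+1) k.+1) ?chordD //.
  have -> : l k.+1 = a by rewrite /a; clear - step step'; lia.
  by rewrite /chord /b; congr edge; clear; lia.
have middle : edge a b \in D :|: external n by rewrite inE chordD.
have [a1b bn] : a + 1 < b /\ b + 1 < a + n%:Z by rewrite /b; clear - lt_k; lia.
have strip_k : strip l k = edge a b by rewrite stripE.
pose t1 := vtx b |: edge a (a + 1); pose t2 := vtx (b + 1) |: edge a b.
have raised : l k + 1 + k.+2%:Z = b + 1 by rewrite /b /a; clear; lia.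
clearbody b.
have [[ab1 a1b1 bb1] [aa1 a_b a1_b]] :
    [/\ vtx a != vtx (b + 1), vtx (a + 1) != vtx (b + 1) & vtx b != vtx (b + 1)] /\
    [/\ vtx a != vtx (a + 1), vtx a != vtx b & vtx (a + 1) != vtx b].
  by split; split; apply/eqP => /vtx_window; clear - a1b bn; lia.
apply/existsP; exists t1; apply/existsP; exists t2.
have t1_tri : triangle D t1.
  apply: triangle_three => //; try by clear - a1b bn; lia.
  by rewrite inE external_edge orbT.
have t2_tri : triangle D t2.
  apply: triangle_three => //; try by clear - a1b bn; lia.
  by rewrite inE external_edge orbT.
rewrite t1_tri t2_tri strip_k /=; apply/and4P; split.
- apply/eqP => /setP/(_ (vtx (b + 1))); rewrite !inE eqxx.
  by rewrite ![vtx (b + 1) == _]eq_sym (negPf ab1) (negPf a1b1) (negPf bb1).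
- by rewrite subUset !sub1set !inE !eqxx ?orbT.
- by rewrite subUset !sub1set !inE !eqxx ?orbT.
apply/eqP/ffunP => j; rewrite stripE [RHS]ffunE; have [->|neq_j] := eqVneq j k; last first.
  by rewrite stripE same.
rewrite up; apply/setP => x; rewrite /chord raised !inE.
have [->|xa] := eqVneq x (vtx a); first by rewrite (negPf aa1) (negPf ab1) ?andbF.
have [->|xb] := eqVneq x (vtx b); first by rewrite eq_sym (negPf a1_b) (negPf bb1) ?andbF.
by rewrite /= orbF orbC.
Qed.

(** * A short path to the reversal *)

(** Among the labels k with [l k < y k], take one where [2 * l k + k], the sum of
the ends of the chord up to a constant, is least. A neighboring label that
blocked raising it would have a smaller sum, hence would be in place already,
and then the step condition on [y] would give [y k <= l k]. *)
Lemma strip_path N l y : stairs l -> stairs y ->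
  (forall k, (k < n - 3)%N -> l k <= y k) ->
  \sum_(k < n - 3) (y k - l k) = N%:Z ->
  exists p, [/\ path (@flip_graph n) (strip l) p, last (strip l) p = strip y & size p = N].
Proof.
elim: N l => [|N IH] l stairs_l stairs_y le_ly sumN;
  have [/existsP[k0 lt_k0]|/existsPn no_k] := boolP [exists k : 'I_(n - 3), l k < y k].
- exfalso; move: sumN; rewrite (bigD1 k0) //=.
  have : 0 <= \sum_(k < n - 3 | k != k0) (y k - l k).
    by apply: sumr_ge0 => k _; rewrite subr_ge0 le_ly.
  by move: (\sum_(k < _ | _) _) => S; clear - lt_k0; lia.
- exists [::]; split=> //; apply/ffunP => k /=; rewrite !stripE; congr chord.
  by have := no_k k; have := le_ly k (ltn_ord k); clear; lia.
- pose F (k : 'I_(n - 3)) := 2 * l k + k%:Z.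
  have [k lt_k min_k] := @arg_minP _ _ _ k0 (fun j : 'I_(n - 3) => l j < y j) F lt_k0.
  pose l' j := if j == k :> nat then l j + 1 else l j.
  have l'k : l' k = l k + 1 by rewrite /l' eqxx.
  have l'j j : j != k :> nat -> l' j = l j by rewrite /l' => /negPf->.
  have min_j j : (j < n - 3)%N -> 2 * l j + j%:Z < 2 * l k + k%:Z -> y j <= l j.
    move=> lt_j lt_Fj; rewrite leNgt; apply/negP => /(min_k (Ordinal lt_j)).
    by rewrite /F /=; clear - lt_Fj; lia.
  have stairs_l' : stairs l'.
    move=> j lt_j; have := stairs_l j lt_j; have := stairs_y j lt_j.
    have [eq_jk|neq_jk] := eqVneq (j : nat) k.
      rewrite eq_jk in lt_j *; rewrite l'k l'j; last by clear; lia.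
      by have := min_j k.+1 lt_j; clear - lt_k; lia.
    have [eq_jk|neq_j1k] := eqVneq j.+1 k; last by rewrite !l'j.
    rewrite eq_jk l'k l'j //; have := min_j j (ltnW lt_j).
    by have := congr1 Posz eq_jk; clear - lt_k; lia.
  have le_l'y j : (j < n - 3)%N -> l' j <= y j.
    move=> lt_j; have [->|neq_j] := eqVneq j (k : nat); last by rewrite l'j // le_ly.
    by rewrite l'k; clear - lt_k; lia.
  have sum_l' : \sum_(j < n - 3) (y j - l' j) = N%:Z.
    move: sumN; rewrite (bigD1 k) //= [RHS in _ -> RHS = _](bigD1 k) //= l'k.
    rewrite (eq_bigr (fun j : 'I_(n - 3) => y j - l' j)); last by move=> j neq_j; rewrite l'j.
    by move: (\sum_(j < _ | _) _) => S; clear; lia.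
  have [p [path_p last_p size_p]] := IH l' stairs_l' stairs_y le_l'y sum_l'.
  exists (strip l' :: p); rewrite /= last_p size_p path_p andbT; split=> //.
  by apply: (strip_raise (k := k)) => // j _; exact: l'j.
- exfalso; move: sumN; rewrite big1 // => k _.
  by have := no_k k; have := le_ly k (ltn_ord k); clear; lia.
Qed.

(** * Counting *)

Lemma card_external : #|external n| = n.
Proof.
rewrite card_imset ?card_ord // => i j.
have [a a_win <-] := vtx_lift 0 i; have [b b_win <-] := vtx_lift 0 j.
rewrite !ordS_vtx => /eq_set2[] [] // /vtx_near + /vtx_near.
by clear - a_win b_win; lia.
Qed.

Lemma card_diagonals : (#|[set d : {set 'I_n} | diagonal d]| + n)%N = 'C(n, 2).
Proof.
have disj : [set d : {set 'I_n} | diagonal d] :&: external n = set0.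
  by apply/setP => e; rewrite !inE /diagonal -andbA andNb andbF.
have union : [set d : {set 'I_n} | diagonal d] :|: external n
    = [set e : {set 'I_n} | #|e| == 2%N].
  apply/setP => e; rewrite !inE /diagonal orbC.
  case: (boolP (e \in external n)) => [|_]; last by rewrite andbT.
  move=> /imsetP[i _ ->]; have [a _ <-] := vtx_lift 0 i.
  by rewrite ordS_vtx card_edge //; clear; lia.
have := cardsUI [set d : {set 'I_n} | diagonal d] (external n).
by rewrite disj union cards0 addn0 card_external card_draws card_ord.
Qed.

Lemma sum_bin2 h : (\sum_(k < h.+2) (h.+3 - k) + h.+4.+1 = 'C(h.+4.+1, 2))%N.
Proof.
elim: h => [|h IH]; first by rewrite !big_ord_recl big_ord0.
rewrite big_ord_recl binS bin1 -IH /=.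
rewrite (eq_bigr (fun k : 'I_h.+2 => h.+3 - k)%N) //.
by clear; lia.
Qed.

(** The labels k and n - 4 - k contribute [l (n - 4 - k) - l k] and its opposite,
so the total length does not depend on [l]. *)
Lemma reversal_path l : stairs l ->
  exists p, [/\ path (@flip_graph n) (strip l) p, last (strip l) p = reversal (strip l)
               & size p = #|[set d : {set 'I_n} | diagonal d]|].
Proof.
move=> stairs_l; rewrite reversal_strip -(stripDM (opposite l) 1).
apply: strip_path => //; first exact: (stairsD _ (stairs_opposite stairs_l)).
  move=> k lt_k; rewrite /opposite.
  have [le_k|/ltnW le_k] := leqP k (n - 4 - k).
    have := @stairs_bounds l k (n - 4 - k) stairs_l le_k.
    by clear - lt_k; lia.
  have := @stairs_bounds l (n - 4 - k) k stairs_l le_k lt_k.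
  by clear - lt_k; lia.
have -> : #|[set d : {set 'I_n} | diagonal d]| = (\sum_(k < n - 3) (n - 2 - k))%N.
  by apply/(@addIn n); rewrite card_diagonals -sum_bin2.
rewrite (big_morph Posz PoszD (erefl : Posz 0 = 0)) /opposite.
rewrite (eq_bigr (fun k : 'I_(n - 3) => (n - 2 - k)%N%:Z + (l (rev_ord k) - l k))).
  have rev_sum : \sum_(k < n - 3) l (rev_ord k) = \sum_(k < n - 3) l k.
    by rewrite [RHS](reindex_inj rev_ord_inj).
  by rewrite big_split sumrB rev_sum subrr; apply: addr0.
move=> k _ /=; have lt_k := ltn_ord k.
have -> : (n - 3 - k.+1)%N = (n - 4 - k)%N by clear; lia.
by clear - lt_k; lia.
Qed.

Lemma sum_flip_count (T : coloring n) p : path (@flip_graph n) T p ->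
  (\sum_(d | diagonal d) flip_count d T p <= size p)%N.
Proof.
elim: p T => [|U p IH] T /=; first by rewrite big1.
case/andP => /flip_graph_step[T_CTFT _ [k neq_k eq_j]] /IH le_p.
rewrite /flip_count /= big_split /= -[(size p).+1]add1n leq_add //.
rewrite (eq_bigr (fun d => if d == T k then 1%N else 0%N)); last first.
  by move=> d _; rewrite (flipped_step _ T_CTFT neq_k eq_j); case: eqP.
rewrite -big_mkcondr sum1dep_card.
apply: (@leq_trans #|pred1 (T k)|); last by rewrite card1.
by apply/subset_leq_card/subsetP => d; rewrite !inE => /andP[].
Qed.

End Lift.

Theorem corollary5p3 (n : nat) (n_gt4 : 4 < n) (T : coloring n)
    (T_CTFT : T \in CTFT n) (p : seq (coloring n))
    (p_shortest : shortest_path (@flip_graph n) T (reversal T) p)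
    (d : {set 'I_n}) (d_diagonal : diagonal d) :
  flip_count d T p = 1.
Proof.
case: n n_gt4 T T_CTFT p p_shortest d d_diagonal => [|[|[|[|[|m]]]]] // _ T T_CTFT p.
case=> path_p last_p min_p d diag_d.
have [l stairs_l eq_T] := CTFT_strip T_CTFT; subst T.
have [q [path_q last_q size_q]] := reversal_path stairs_l.
have flipped_once e : diagonal e -> 0 < flip_count e (strip m l) p.
  exact: every_diagonal_flipped.
have le_p : \sum_(e | diagonal e) flip_count e (strip m l) p <=
    \sum_(e : {set 'I_m.+4.+1} | diagonal e) 1.
  rewrite sum1dep_card -size_q.
  exact: leq_trans (sum_flip_count path_p) (min_p q path_q last_q).
rewrite (bigD1 d) //= [leqRHS](bigD1 d) //= in le_p.
have le_rest : \sum_(e : {set 'I_m.+4.+1} | diagonal e && (e != d)) 1 <=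
    \sum_(e | diagonal e && (e != d)) flip_count e (strip m l) p.
  by apply: leq_sum => e /andP[diag_e _]; apply: flipped_once.
apply/eqP; rewrite eqn_leq flipped_once // andbT.
rewrite -(leq_add2r (\sum_(e : {set 'I_m.+4.+1} | diagonal e && (e != d)) 1)).
by rewrite (leq_trans _ le_p) // leq_add2l.
Qed.
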